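(* Let $T$ be a measure preserving transformation on a separable, nonatomic probability space. If $T$ has a mildly mixing factor (on a separable, nonatomic probability space), then $T$ is lightly mixing on a dense algebra.
   Context: A transformation on a probability space $(X,\mathcal{B},\mu)$ is an invertible measurable map $T:X\to X$ with measurable inverse; it is measure preserving if $\mu(T^{-1}A)=\mu(A)$ for all $A\in\mathcal{B}$. The space is separable in the sense that $\mathcal{B}$ (modulo null sets) is a separable metric space under the distance $d(A,B)=\mu(A\triangle B)$; dense means dense for $d$. A measure preserving transformation $S$ on $(Y,\mathcal{C},\nu)$ is a factor of $T$ on $(X,\mathcal{B},\mu)$ if there is a measurable $\pi:X\to Y$ with $\mu(\pi^{-1}C)=\nu(C)$ for all $C\in\mathcal{C}$ and $\pi\circ T=S\circ\pi$ almost everywhere. The factor is trivial if $\nu(C)\in\{0,1\}$ for all $C\in\mathcal{C}$. A transformation $S$ on $(Y,\mathcal{C},\nu)$ is rigid if there is a sequence of integers $n_k\to\infty$ with $\nu(S^{n_k}C\triangle C)\to 0$ for all $C\in\mathcal{C}$. A transformation is mildly mixing if it has no nontrivial rigid factor. $T$ is lightly mixing on a dense algebra if there is an algebra of sets $\mathcal{G}\subset\mathcal{B}$, dense in $\mathcal{B}$, such that $\liminf_{n\to\infty}\mu(T^nA\cap B)>0$ for all $A,B\in\mathcal{G}$ having positive measure. *)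

(* Defs.v *)
From HB Require Import structures.
From mathcomp Require Import all_boot all_order all_algebra.
From mathcomp Require Import all_classical all_reals all_analysis.

Set Implicit Arguments.
Unset Strict Implicit.
Unset Printing Implicit Defensive.

Import Order.TTheory GRing.Theory Num.Theory.
Import numFieldNormedType.Exports.

Local Open Scope classical_set_scope.
Local Open Scope ring_scope.

Section probability_spaces.
Context {R : realType} {d : measure_display} {X : measurableType d}.
Variable mu : probability X R.

(* Density, among the measurable sets, for the pseudometric
   d(A, B) = mu (A `+` B), where `+` is the symmetric difference. *)
Definition measure_dense (G : set (set X)) : Prop :=
  G `<=` measurable /\
  forall (A : set X) (e : R), measurable A -> 0 < e ->
    exists2 B, G B & (mu (A `+` B) < e%:E)%E.

Definition separable_space : Prop :=
  exists2 D : set (set X), countable D & measure_dense D.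

Definition atom (A : set X) : Prop :=
  [/\ measurable A, (0 < mu A)%E &
      forall B, measurable B -> B `<=` A -> mu B = 0%E \/ mu B = mu A].

Definition nonatomic : Prop := ~ exists A, atom A.

Definition transformation (T : X -> X) : Prop :=
  measurable_fun setT T /\
  exists T' : X -> X, [/\ cancel T T', cancel T' T & measurable_fun setT T'].

Definition measure_preserving (T : X -> X) : Prop :=
  forall A, measurable A -> mu (T @^-1` A) = mu A.

Definition mp_transformation (T : X -> X) : Prop :=
  transformation T /\ measure_preserving T.

Definition trivial_space : Prop :=
  forall C, measurable C -> mu C = 0%E \/ mu C = 1%E.

Definition rigid (T : X -> X) : Prop :=
  exists2 n : nat -> nat, n k @[k --> \oo] --> \oo &
    forall C, measurable C ->
      mu ((iter (n k) T @` C) `+` C) @[k --> \oo] --> 0%E.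

Definition algebra_of_sets (G : set (set X)) : Prop :=
  [/\ G setT, setC_closed G & setU_closed G].

Definition lightly_mixing_on_dense_algebra (T : X -> X) : Prop :=
  exists G : set (set X), [/\ algebra_of_sets G, measure_dense G &
    forall A B, G A -> G B -> (0 < mu A)%E -> (0 < mu B)%E ->
      (0 < limn_einf (fun n => mu ((iter n T @` A) `&` B)))%E].

End probability_spaces.

Definition is_factor {R : realType}
    {d : measure_display} {X : measurableType d}
    (mu : probability X R) (T : X -> X)
    {d' : measure_display} {Y : measurableType d'}
    (nu : probability Y R) (S : Y -> Y) : Prop :=
  mp_transformation nu S /\
  exists p : X -> Y,
    [/\ measurable_fun setT p,
        forall C, measurable C -> mu (p @^-1` C) = nu C &
        {ae mu, forall x, p (T x) = S (p x)}].

Definition mildly_mixing {R : realType}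
    {d : measure_display} {X : measurableType d}
    (mu : probability X R) (T : X -> X) : Prop :=
  forall (d' : measure_display) (Y : measurableType d')
    (nu : probability Y R) (S : Y -> Y),
    is_factor mu T nu S -> rigid nu S -> trivial_space nu.

(* Main.v *)
Require Import Defs.
From HB Require Import structures.
From mathcomp Require Import all_boot all_order all_algebra.
From mathcomp Require Import all_classical all_reals all_analysis.
From mathcomp Require Import lra zify.

Set Implicit Arguments.
Unset Strict Implicit.
Unset Printing Implicit Defensive.

Import Order.TTheory GRing.Theory Num.Theory.
Import numFieldNormedType.Exports.

Local Open Scope classical_set_scope.
Local Open Scope ring_scope.

(** Write S for the mildly mixing factor, nu for its measure and p for the
    factor map.  Mild mixing enters in one way only: if [0 < nu U < 1], then
    [nu (U `\` S^n U)] stays away from 0 for large n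
    ([mildly_mixing_escape]); otherwise the sets C with S^(n_k) C -> C along
    some n_k -> oo would form a sigma-algebra, hence a rigid factor, which U
    makes nontrivial.

    The heart of the proof is to find, inside sets of arbitrarily small measure,
    disjoint F and J such that [nu (S^n F `&` J)] stays away from 0
    ([lightly_meeting_pair]).  Take a very small set B and let tau x be the first
    t >= 0 such that S^(-t) x lies in B; almost every point has such a t.  Let F
    be the set where k divides tau, except that the level tau = k is left out.
    Then the first k points of a backward orbit meet F, unless the orbit starts
    in U = [k <= tau < 2 k].  The first k points of an orbit
    which starts in U stay inside J = [1 <= tau < 2 k], which is disjoint from F
    exactly because level k was left out.  So a point of U outside S^n U has,
    among the first k points of its backward orbit, one in S^n F; and that one
    is in J.
    Hence [nu (U `\` S^n U) <= k * nu (S^n F `&` J)], and escape of U gives the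
    claim.  The measure of F is at most nu B + 1 / k and that of J at most
    2 k nu B.

    Choosing such pairs (F_t, J_t) with measures decreasing fast enough, compared
    to the lower bounds obtained for the previous pairs, and removing from each
    of them everything that comes later, yields pairs that are disjoint from one
    another, still keep meeting, and have arbitrarily small tails T_m
    ([lightly_meeting_family]).

    These pairs are used as markers.  Let a_0, a_1, ... be dense in the space of
    T.  To F_t and to J_t attach finite words of bits, so that every pair of
    words occurs for infinitely many t.  Change a_m only over the tail T_m,
    putting the whole fibre over F_t (or J_t) into the new set, or the
    whole fibre outside of it, according to the m-th bit of the word
    ([recoded]).  The new sets are as close to the a_m as the tails are small,
    and they generate an algebra.  A nonempty member of it that depends on the
    first m generators contains the fibre over F_t for each t >= m whose word
    records how one of its points is placed; the same holds for J_t.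
    Given two members A and B, some t serves for A through F_t and for B through
    J_t, so that T^n A and B meet at least as much as S^n F_t and J_t do. *)

(** * Real-valued probabilities *)

(** Probabilities are finite; as plain reals they are in the reach of linear
    arithmetic. *)
Definition pr {R : realType} {d} {X : measurableType d}
  (mu : probability X R) (A : set X) : R := fine (mu A).

Section real_valued_probability.
Context {R : realType} {d : measure_display} {X : measurableType d}.
Variable mu : probability X R.
Implicit Types A B : set X.

Lemma EFin_pr A : measurable A -> (pr mu A)%:E = mu A.
Proof. by move=> mA; rewrite fineK // fin_num_measure. Qed.

Lemma pr_ge0 A : 0 <= pr mu A.
Proof. exact/fine_ge0/measure_ge0. Qed.

Lemma prT : pr mu setT = 1.
Proof. by rewrite /pr probability_setT. Qed.

Lemma pr0 : pr mu set0 = 0.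
Proof. by rewrite /pr measure0. Qed.

Lemma pr_le A B : measurable A -> measurable B -> A `<=` B -> pr mu A <= pr mu B.
Proof.
move=> mA mB AB; rewrite -lee_fin !EFin_pr //.
by apply: le_measure; rewrite ?inE.
Qed.

Lemma pr_le1 A : measurable A -> pr mu A <= 1.
Proof. by move=> mA; rewrite -prT; exact: pr_le. Qed.

Lemma prU A B : measurable A -> measurable B -> A `&` B = set0 ->
  pr mu (A `|` B) = pr mu A + pr mu B.
Proof.
move=> mA mB AB; apply: EFin_inj.
by rewrite EFinD !EFin_pr ?measureU //; exact: measurableU.
Qed.

Lemma prC A : measurable A -> pr mu (~` A) = 1 - pr mu A.
Proof.
move=> mA; apply: EFin_inj.
by rewrite EFinB !EFin_pr ?probability_setC //; exact: measurableC.
Qed.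

Lemma prDI A B : measurable A -> measurable B ->
  pr mu (A `\` B) = pr mu A - pr mu (A `&` B).
Proof.
move=> mA mB; apply: EFin_inj; rewrite EFinB !EFin_pr //.
- by rewrite measureD // -ge0_fin_numE // fin_num_measure.
- exact: measurableI.
- exact: measurableD.
Qed.

Lemma pr_bigcup_le (A : nat -> set X) (c : R) : (forall i, measurable (A i)) ->
  (forall n, \sum_(i < n) pr mu (A i) <= c) -> pr mu (\bigcup_i A i) <= c.
Proof.
move=> mA cA; have mU : measurable (\bigcup_i A i) by exact: bigcupT_measurable.
rewrite -lee_fin EFin_pr //.
apply: (le_trans (measure_sigma_subadditive _ mA mU (@subset_refl _ _))).
apply: lime_le; first by apply: is_cvg_nneseries => *; exact: measure_ge0.
apply: nearW => n; rewrite big_mkord.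
rewrite (eq_bigr (fun i : 'I_n => (pr mu (A i))%:E)) => [|i _]; last first.
  by rewrite EFin_pr.
by rewrite sumEFin lee_fin; exact: cA.
Qed.

Lemma pr_bigcupn_le (A : nat -> set X) n : (forall i, measurable (A i)) ->
  pr mu (\bigcup_(i in `I_n) A i) <= \sum_(i < n) pr mu (A i).
Proof.
move=> mA; rewrite bigcup_mkcond; apply: pr_bigcup_le => [i|m].
  by case: ifP.
have E (i : nat) : pr mu (if i \in `I_n then A i else set0) <= pr mu (A i).
  by case: ifP => // _; rewrite pr0 pr_ge0.
case: (leqP m n) => mn.
  apply: (le_trans (ler_sum _ (fun (i : 'I_m) _ => E i))).
  rewrite (big_ord_widen _ (fun i => pr mu (A i)) mn) [leLHS]big_mkcond /=.
  by apply: ler_sum => i _; case: ifP => // _; exact: pr_ge0.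
rewrite (big_ord_widen _ (fun i => pr mu (A i)) (ltnW mn)) [leRHS]big_mkcond /=.
apply: ler_sum => i _; case: ltnP => ni; first exact: E.
by rewrite memNset ?pr0 //= ltnNge ni.
Qed.

Lemma prU_le A B : measurable A -> measurable B ->
  pr mu (A `|` B) <= pr mu A + pr mu B.
Proof.
move=> mA mB; have -> : A `|` B = A `|` (B `\` A).
  by rewrite setDE setUIr setUv setIT.
have mD : measurable (B `\` A) by exact: measurableD.
rewrite prU //; first by rewrite lerD2l pr_le //; exact: subDsetl.
by rewrite -subset0 => x [? []].
Qed.

Lemma pr_subadd A B C : measurable A -> measurable B -> measurable C ->
  A `<=` B `|` C -> pr mu A <= pr mu B + pr mu C.
Proof.
move=> mA mB mC ABC; apply: le_trans (prU_le mB mC).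
by apply: pr_le => //; exact: measurableU.
Qed.

Lemma pr_bigcup_trivI (A : nat -> set X) n : (forall i, measurable (A i)) ->
  (forall i j, (i < n)%N -> (j < n)%N -> A i `&` A j !=set0 -> i = j) ->
  \sum_(i < n) pr mu (A i) <= 1.
Proof.
move=> mA tA; have -> : \sum_(i < n) pr mu (A i) = pr mu (\big[setU/set0]_(i < n) A i).
  apply: EFin_inj; rewrite EFin_pr; last by apply: bigsetU_measurable.
  rewrite measure_bigsetU_ord //.
    by rewrite -sumEFin; apply: eq_bigr => i _; rewrite EFin_pr.
  by move=> i j _ _ /(tA _ _ (ltn_ord i) (ltn_ord j)) /ord_inj.
by apply: pr_le1; exact: bigsetU_measurable.
Qed.

(** Continuity from above, along the remainders of the union. *)
Lemma pr_tail (A : nat -> set X) (e : R) : (forall i, measurable (A i)) -> 0 < e ->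
  exists N, pr mu ((\bigcup_i A i) `\` (\bigcup_(i in `I_N) A i)) < e.
Proof.
move=> mA e0; pose F n := \bigcup_i A i `\` \bigcup_(i in `I_n) A i.
have mU : measurable (\bigcup_i A i) by exact: bigcupT_measurable.
have mF n : measurable (F n) by apply: measurableD => //; exact: bigcup_measurable.
have F0 : \bigcap_n F n = set0.
  rewrite -subset0 => x Fx; have [[i _ Aix] _] := Fx 0%N I.
  by have [_] := Fx i.+1 I; apply; exists i => //=.
have := @nonincreasing_cvg_mu _ _ _ mu F.
rewrite F0 measure0 => /(_ _ mF measurable0) FF.
have {FF} : mu \o F @ \oo --> 0%E.
  apply: FF; first by rewrite -ge0_fin_numE // fin_num_measure.
  move=> m n mn; apply/subsetPset => x [Ux nx]; split => //.
  by move=> [i /= im Aix]; apply: nx; exists i => //=; exact: leq_trans im mn.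
move=> /fine_cvgP [_] /cvgrPdist_lt /(_ _ e0) [N _ NF]; exists N.
have := NF N (leqnn N); rewrite /= sub0r normrN => /(le_lt_trans (ler_norm _)).
by [].
Qed.

End real_valued_probability.

(** * Measure preserving maps and mild mixing *)

Section measure_preserving_maps.
Context {R : realType} {d : measure_display} {X : measurableType d}.
Variable mu : probability X R.
Implicit Types f : X -> X.

(** Unlike [measure_preserving], this includes measurability, so that it is
    inherited by iterates and holds of the inverse of a transformation. *)
Definition mpmap f : Prop := forall A, measurable A ->
  measurable (f @^-1` A) /\ pr mu (f @^-1` A) = pr mu A.

Lemma mpmap_iter f n : mpmap f -> mpmap (iter n f).
Proof.
move=> mpf; elim: n => [A mA|n IH A mA]; first by split.
have [mfA fA] := mpf _ mA; have [mA' fA'] := IH _ mfA.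
by rewrite -fA -fA'.
Qed.

Lemma mp_inverse f : mp_transformation mu f ->
  exists g, [/\ cancel f g, cancel g f, mpmap f & mpmap g].
Proof.
move=> [[mf [g [fK gK mg]]] pf]; exists g.
have mpf : mpmap f.
  move=> A mA; split; last by rewrite /pr pf.
  by rewrite -[_ @^-1` _]setTI; exact: mf.
split => // A mA.
have mgA : measurable (g @^-1` A) by rewrite -[_ @^-1` _]setTI; exact: mg.
split => //; have [_ <-] := mpf _ mgA.
by congr (pr mu _); apply/seteqP; split => x /=; rewrite fK.
Qed.

Lemma iter_cancel f g n : cancel f g -> cancel (iter n f) (iter n g).
Proof. by move=> fK; elim: n => // n IH x; rewrite iterSr /= fK IH. Qed.

(** Preimages under the inverse commute with all set operations and are covered
    by [mpmap], hence replace the images in the definitions of rigidity and of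
    light mixing. *)
Lemma image_iter f g n A : cancel f g -> cancel g f ->
  iter n f @` A = iter n g @^-1` A.
Proof.
move=> fK gK; apply/seteqP; split => [_ [x Ax <-] /=|x /= Ax].
  by rewrite (iter_cancel n fK).
by exists (iter n g x) => //; rewrite (iter_cancel n gK).
Qed.

End measure_preserving_maps.

Section mild_mixing.
Context {R : realType} {d : measure_display} {Y : measurableType d}.
Variable nu : probability Y R.
Implicit Types Q S : Y -> Y.

(** With Q the inverse of S, these are the sets C such that S^(n_k) C -> C. *)
Definition rigid_sets Q (n : nat -> nat) : set (set Y) :=
  [set C | measurable C /\ forall e : R, 0 < e -> \forall k \near \oo,
    pr nu ((iter (n k) Q @^-1` C) `+` C) < e].

(** For a countable union, all but finitely many of the sets are absorbed in a
    small remainder W, which moves to a set of the same measure; the finitely many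
    others are handled one by one. *)
Lemma rigid_sets_sigma_algebra Q n : mpmap nu Q ->
  sigma_algebra setT (rigid_sets Q n).
Proof.
move=> mpQ; split=> [|C [mC rC]|A rA].
- split=> // e e0; apply: nearW => k.
  by rewrite preimage_set0 setYK pr0.
- rewrite setTD; split; first exact: measurableC.
  move=> e /rC; apply: filterS => k; congr (pr nu _ < e).
  rewrite preimage_setC /setY !setDE !setCK setUC.
  by rewrite [X in X `|` _]setIC [X in _ `|` X]setIC.
have mA i : measurable (A i) by have [] := rA i.
have mU : measurable (\bigcup_i A i) by exact: bigcupT_measurable.
split => // e e0; have e4 : 0 < e / 4 by lra.
have [N We] := pr_tail nu mA e4; set W := _ `\` _ in We.
have mW : measurable W.
  by apply: measurableD => //; exact: bigcup_measurable.
have e5 : 0 < e / 4 / N.+1%:R by exact: divr_gt0.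
have near_all : \forall k \near \oo, forall i : 'I_N,
    pr nu ((iter (n k) Q @^-1` A i) `+` A i) < e / 4 / N.+1%:R.
  by apply: filter_forall => i; have [_] := rA i; exact.
apply: filterS near_all => k Ak.
have mpn := mpmap_iter (n k) mpQ.
pose D i := (iter (n k) Q @^-1` A i) `+` A i.
have mD i : measurable (D i).
  have [m1 _] := mpn _ (mA i).
  by rewrite /D /=; apply: measurableU; apply: measurableD.
have [mQW prQW] := mpn _ mW.
have mDU : measurable (\bigcup_(i in `I_N) D i) by exact: bigcup_measurable.
have sub : (iter (n k) Q @^-1` (\bigcup_i A i)) `+` (\bigcup_i A i) `<=`
    ((iter (n k) Q @^-1` W) `|` W) `|` \bigcup_(i in `I_N) D i.
  move=> x [[[i _ Qx] nx]|[[i _ Ax] nx]].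
  - case: (pselect ((\bigcup_(i in `I_N) A i) (iter (n k) Q x))) => h.
      case: h => j jN Qxj; right; exists j => //; left; split => // Axj.
      by apply: nx; exists j.
    by left; left; split => //; exists i.
  - case: (pselect ((\bigcup_(i in `I_N) A i) x)) => h.
      case: h => j jN Axj; right; exists j => //; right; split => // Qxj.
      by apply: nx; exists j.
    by left; right; split => //; exists i.
have [mQU _] := mpn _ mU.
have mY : measurable ((iter (n k) Q @^-1` (\bigcup_i A i)) `+` (\bigcup_i A i)).
  by apply: measurableU; apply: measurableD.
apply: (le_lt_trans (pr_subadd nu mY (measurableU _ _ mQW mW) mDU sub)).
have := prU_le nu mQW mW; rewrite prQW.
have := pr_bigcupn_le nu N mD.
have : \sum_(i < N) pr nu (D i) <= e / 4.
  apply: (@le_trans _ _ (\sum_(i < N) (e / 4 / N.+1%:R))).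
    by apply: ler_sum => i _; exact: ltW (Ak i).
  rewrite sumr_const card_ord -[_ *+ N]mulr_natr mulrAC ler_pdivrMr ?ltr0n //.
  by rewrite ler_pM2l // ler_nat.
lra.
Qed.

Lemma rigid_sets_preimage S Q n C : cancel S Q -> cancel Q S ->
  mpmap nu S -> mpmap nu Q -> rigid_sets Q n C ->
  rigid_sets Q n (S @^-1` C) /\ rigid_sets Q n (Q @^-1` C).
Proof.
move=> SK QK mpS mpQ [mC rC].
have comm f : mpmap nu f -> (forall m x, iter m Q (f x) = f (iter m Q x)) ->
    rigid_sets Q n (f @^-1` C).
  move=> mpf fQ; split; first by have [] := mpf _ mC.
  move=> e /rC; apply: filterS => k.
  have [m1 _] := mpmap_iter (n k) mpQ mC.
  have mY : measurable ((iter (n k) Q @^-1` C) `+` C).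
    by apply: measurableU; apply: measurableD.
  have [_ <-] := mpf _ mY; congr (pr nu _ < e).
  by apply/seteqP; split => x /=; rewrite fQ.
split; apply: comm => //; last by move=> m x; rewrite -iterSr iterS.
by elim=> //= m IH x; rewrite IH SK QK.
Qed.

(** The sigma-algebra of rigid sets, on the same underlying type and with the
    identity as factor map, is a rigid factor. *)
Lemma rigid_sets_trivial S Q n C : mp_transformation nu S ->
  cancel S Q -> cancel Q S -> mpmap nu S -> mpmap nu Q -> mildly_mixing nu S ->
  n k @[k --> \oo] --> \oo -> rigid_sets Q n C -> pr nu C = 0 \/ pr nu C = 1.
Proof.
move=> mpS SK QK pS pQ mm noo rC.
pose G := rigid_sets Q n; have sG := rigid_sets_sigma_algebra n pQ.
pose Y' : measurableType _ := g_sigma_algebraType G.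
have mG : (measurable : set (set Y')) = G by exact: measurable_g_measurableTypeE.
have mid : measurable_fun setT (idfun : Y -> Y').
  by move=> _ A; rewrite mG setTI => -[].
pose idm : {mfun Y >-> Y'} := HB.pack (idfun : Y -> Y')
  (isMeasurableFun.Build _ _ _ _ (idfun : Y -> Y') mid).
pose nu' : probability Y' R := distribution nu idm.
have nuE (A : set Y) : nu' A = nu A by [].
have mpS' : mp_transformation nu' (S : Y' -> Y').
  split; last by move=> A; rewrite mG => -[mA _]; exact: (mpS.2).
  split; first by move=> _ A; rewrite !mG setTI => /(rigid_sets_preimage SK QK pS pQ)[].
  exists Q; split => //.
  by move=> _ A; rewrite !mG setTI => /(rigid_sets_preimage SK QK pS pQ)[].
have := mm _ Y' nu' S.
have fac : is_factor nu S nu' (S : Y' -> Y').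
  split => //; exists idm; split => //.
  by apply: aeW.
have rig : rigid nu' (S : Y' -> Y').
  exists n => // A; rewrite mG => -[mA rA].
  have mm' k : measurable ((iter (n k) Q @^-1` A) `+` A).
    have [m1 _] := mpmap_iter (n k) pQ mA.
    by apply: measurableU; apply: measurableD.
  apply/fine_cvgP; split.
    by apply: nearW => k; rewrite (image_iter _ _ SK QK) nuE fin_num_measure.
  apply/cvgrPdist_lt => e /rA; apply: filterS => k.
  rewrite /= sub0r normrN ger0_norm ?fine_ge0 ?measure_ge0 //.
  by rewrite (image_iter _ _ SK QK).
move=> /(_ fac rig) /(_ C); rewrite mG => /(_ rC) [h|h]; [left|right].
  by rewrite /pr (h : nu C = 0%E).
by rewrite /pr (h : nu C = 1%E).
Qed.

(** If C returned almost completely to itself at arbitrarily large times, C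
    would be rigid along these times.  Only one half of the symmetric difference
    has to be controlled, since both halves have the same measure. *)
Lemma mildly_mixing_escape S Q C : mp_transformation nu S ->
  cancel S Q -> cancel Q S -> mpmap nu S -> mpmap nu Q -> mildly_mixing nu S ->
  measurable C -> 0 < pr nu C < 1 ->
  exists2 c : R, 0 < c & \forall n \near \oo, c <= pr nu (C `\` iter n Q @^-1` C).
Proof.
move=> mpS SK QK pS pQ mm mC /andP[C0 C1]; apply: contrapT => nesc.
have ret k : exists n, (k <= n)%N /\
    pr nu (C `\` iter n Q @^-1` C) < k.+1%:R^-1.
  apply: contrapT => nret; apply: nesc; exists k.+1%:R^-1 => //.
  exists k => // n /= kn; rewrite leNgt; apply/negP => lt_n.
  by apply: nret; exists n.
have [n nP] := choice ret.
have noo : n k @[k --> \oo] --> \oo.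
  move=> U [N _ NU]; exists N => // k /= Nk; apply: NU => /=.
  by apply: leq_trans Nk _; have [] := nP k.
have rC : rigid_sets Q n C.
  split=> // e e0; have e2 : 0 < e / 2 by lra.
  have /cvgrPdist_lt /(_ _ e2) := @cvg_harmonic R.
  apply: filterS => k; rewrite /= sub0r normrN gtr0_norm ?invr_gt0 // => ke.
  have [m1 p1] := mpmap_iter (n k) pQ mC.
  have := prU_le nu (measurableD m1 mC) (measurableD mC m1).
  have -> : pr nu ((iter (n k) Q @^-1` C) `\` C) = pr nu (C `\` iter (n k) Q @^-1` C).
    by rewrite !prDI // p1 setIC.
  have := (nP k).2; rewrite /setY /=; move: ke; set u := k.+1%:R^-1; lra.
have [] := rigid_sets_trivial mpS SK QK pS pQ mm noo rC; lra.
Qed.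

End mild_mixing.

(** * Small sets that keep meeting each other *)

Section small_sets.
Context {R : realType} {d : measure_display} {Y : measurableType d}.
Variable nu : probability Y R.

(** Either a set that witnesses that A is not an atom, or its complement in A,
    has at most half of the measure. *)
Lemma nonatomic_half A : nonatomic nu -> measurable A -> 0 < pr nu A ->
  exists B, measurable B /\ 0 < pr nu B <= pr nu A / 2.
Proof.
move=> na mA A0.
have [B [mB BA B0 BneA]] : exists B,
    [/\ measurable B, B `<=` A, pr nu B != 0 & pr nu B != pr nu A].
  apply: contrapT => nB; apply: na; exists A; split => //.
    by rewrite -EFin_pr // lte_fin.
  move=> B mB BA; rewrite -!EFin_pr //.
  have [->|B0] := eqVneq (pr nu B) 0; first by left.
  have [->|BneA] := eqVneq (pr nu B) (pr nu A); first by right.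
  by exfalso; apply: nB; exists B.
have lB := pr_le nu mB mA BA.
have ltB : pr nu B < pr nu A by rewrite lt_neqAle BneA.
have gtB : 0 < pr nu B by rewrite lt_neqAle eq_sym B0 pr_ge0.
have [le_half|gt_half] := leP (pr nu B) (pr nu A / 2).
  by exists B; rewrite gtB.
exists (A `\` B); split; first exact: measurableD.
rewrite prDI // (_ : A `&` B = B); first lra.
by rewrite setIC; exact: setIidl.
Qed.

Lemma nonatomic_small (e : R) : nonatomic nu -> 0 < e ->
  exists B, measurable B /\ 0 < pr nu B < e.
Proof.
move=> na e0.
have small n : exists B, measurable B /\ 0 < pr nu B <= n.+1%:R^-1.
  elim: n => [|n [B [mB /andP[B0 Bn]]]].
    by exists setT; rewrite prT invr1 ltr01 lexx; split.
  have [C [mC /andP[C0 CB]]] := nonatomic_half na mB B0.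
  exists C; split => //; rewrite C0 (le_trans CB) //.
  apply: (@le_trans _ _ (n.+1%:R^-1 / 2)); first by rewrite ler_pM2r.
  by rewrite -invfM lef_pV2 ?posrE ?mulr_gt0 ?ltr0n // -natrM ler_nat; lia.
have [N _ /(_ N (leqnn N))] := near_infty_natSinv_lt (PosNum e0).
have [B [mB /andP[B0 BN]]] := small N; exists B; split => //.
by rewrite B0 (le_lt_trans BN).
Qed.

End small_sets.

Section first_hits.
Context {R : realType} {d : measure_display} {Y : measurableType d}.
Variable nu : probability Y R.
Variables (Q : Y -> Y) (B : set Y).

(** The level tau = t, where tau is the first time at which the orbit under Q
    enters B. *)
Definition first_hit (t : nat) : set Y :=
  [set x | B (iter t Q x) /\ forall s, (s < t)%N -> ~ B (iter s Q x)].

Lemma first_hit_inj s t x : first_hit s x -> first_hit t x -> s = t.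
Proof.
move=> [Bs ns] [Bt nt]; case: (ltngtP s t) => // [st|ts].
  by case: (nt _ st).
by case: (ns _ ts).
Qed.

Lemma first_hit_ex t x : B (iter t Q x) -> exists s, first_hit s x.
Proof.
elim/ltn_ind: t => t IH Bt.
case: (pselect (exists2 s, (s < t)%N & B (iter s Q x))) => [[s st Bs]|nt].
  exact: IH st Bs.
by exists t; split => // s st Bs; apply: nt; exists s.
Qed.

Lemma first_hit_shift t i x : (i <= t)%N -> first_hit t x ->
  first_hit (t - i) (iter i Q x).
Proof.
move=> it [Bt nt]; split; first by rewrite -iterD subnK.
by move=> s st; rewrite -iterD; apply: nt; lia.
Qed.

Hypotheses (mB : measurable B) (pQ : mpmap nu Q).

Lemma measurable_first_hit t : measurable (first_hit t).
Proof.
rewrite (_ : first_hit t = (iter t Q @^-1` B) `\`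
    \bigcup_(s in `I_t) (iter s Q @^-1` B)).
  apply: measurableD; first by have [] := mpmap_iter t pQ mB.
  by apply: bigcup_measurable => s _; have [] := mpmap_iter s pQ mB.
apply/seteqP; split => x [Bx nx]; split => //.
  by case=> s /= st; exact: nx.
by move=> s st Bs; apply: nx; exists s.
Qed.

Lemma pr_first_hit_le t : pr nu (first_hit t) <= pr nu B.
Proof.
have [mtB <-] := mpmap_iter t pQ mB.
by apply: pr_le => //; [exact: measurable_first_hit|move=> x []].
Qed.

Lemma pr_first_hits_le n :
  pr nu (\bigcup_(t in `I_n) first_hit t) <= n%:R * pr nu B.
Proof.
apply: le_trans (pr_bigcupn_le nu n measurable_first_hit) _.
apply: (@le_trans _ _ (\sum_(i < n) pr nu B)).
  by apply: ler_sum => i _; exact: pr_first_hit_le.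
by rewrite sumr_const card_ord mulr_natl.
Qed.

End first_hits.

Section lightly_meeting_pairs.
Context {R : realType} {d : measure_display} {Y : measurableType d}.
Variable nu : probability Y R.
Variables (S Q : Y -> Y).
Hypotheses (na : nonatomic nu) (mpS : mp_transformation nu S).
Hypotheses (SK : cancel S Q) (QK : cancel Q S).
Hypotheses (pS : mpmap nu S) (pQ : mpmap nu Q) (mm : mildly_mixing nu S).

(** The set V of points that ever visit B contains its preimages under Q, which
    have the same measure; so V does not escape from itself. *)
Lemma hits_full B : measurable B -> 0 < pr nu B ->
  pr nu (\bigcup_t (iter t Q @^-1` B)) = 1.
Proof.
move=> mB B0; set V := \bigcup_t _.
have mtB t : measurable (iter t Q @^-1` B) by have [] := mpmap_iter t pQ mB.
have mV : measurable V by exact: bigcupT_measurable.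
have V0 : 0 < pr nu V.
  by apply: (lt_le_trans B0); apply: pr_le => // x Bx; exists 0%N.
apply/eqP; rewrite eq_le pr_le1 //= leNgt; apply/negP => V1.
have [|c c0 [N _ /(_ N (leqnn N)) /=]] := mildly_mixing_escape mpS SK QK pS pQ mm mV.
  by rewrite V0.
have [mNV pNV] := mpmap_iter N pQ mV.
rewrite prDI // (_ : V `&` _ = iter N Q @^-1` V) ?pNV ?subrr; first by lra.
rewrite setIC; apply: setIidl => x [t _ /= Bt].
by exists (t + N)%N => //=; rewrite iterD.
Qed.

(** The sets F, J and U are those of the introduction, S^n C being the preimage
    of C under the n-th iterate of Q. *)
Lemma lightly_meeting_pair (e : R) : 0 < e -> exists F J : set Y,
  [/\ measurable F, measurable J, F `&` J = set0, pr nu (F `|` J) < e &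
      exists2 c : R, 0 < c &
        \forall n \near \oo, c <= pr nu ((iter n Q @^-1` F) `&` J)].
Proof.
move=> e0; have e4 : 0 < e / 4 by lra.
have [k k_gt0 k_e] : exists2 k, (0 < k)%N & k%:R^-1 < e / 4.
  have [k _ /(_ k (leqnn k)) /= k_e] := near_infty_natSinv_lt (PosNum e4).
  by exists k.+1.
have k0' : (0 : R) < k%:R by rewrite ltr0n.
have b0 : 0 < Num.min e 1 / 4 / k%:R.
  by rewrite !divr_gt0 // lt_min e0 ltr01.
have [B [mB /andP[B0 Bb]]] := nonatomic_small na b0.
have kB : k%:R * pr nu B < Num.min e 1 / 4 by rewrite mulrC -ltr_pdivlMr.
have [kBe kB1] : k%:R * pr nu B < e / 4 /\ k%:R * pr nu B < 1 / 4.
  by split; apply: (lt_le_trans kB); rewrite ler_pM2r ?invr_gt0 // ge_min lexx ?orbT.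
have Be : pr nu B < e / 4.
  by apply: le_lt_trans kBe; rewrite ler_peMl ?pr_ge0 // ler1n.
pose L := first_hit Q B.
have mL := measurable_first_hit mB pQ; rewrite -/L in mL.
pose F := \bigcup_(t in [set t | (k %| t)%N && (t != k)]) L t.
pose F1 := \bigcup_(t in [set t | (k %| t)%N && (k < t)%N]) L t.
pose J := \bigcup_(t in [set t | (0 < t < k.*2)%N]) L t.
pose U := \bigcup_(t in [set t | (k <= t < k.*2)%N]) L t.
have mF : measurable F by exact: bigcup_measurable.
have mF1 : measurable F1 by exact: bigcup_measurable.
have mJ : measurable J by exact: bigcup_measurable.
have mU : measurable U by exact: bigcup_measurable.
have prJ : pr nu J <= 2 * (k%:R * pr nu B).
  have -> : 2 * (k%:R * pr nu B) = k.*2%:R * pr nu B.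
    by rewrite -muln2 natrM mulrA [2 * _]mulrC.
  apply: le_trans (pr_first_hits_le mB pQ k.*2); apply: pr_le => //.
    by apply: bigcup_measurable => *; exact: (measurable_first_hit mB pQ).
  by move=> x [t /= /andP[_ tk] Lt]; exists t.
have leUJ : pr nu U <= pr nu J.
  apply: pr_le => // x [t /= /andP[kt tk] Lt]; exists t => //=.
  by rewrite tk (leq_trans _ kt).
(* The preimages of F1 under the first k powers of S are disjoint: on the
   i-th one, tau is congruent to - i modulo k. *)
have prF1 : pr nu F1 <= k%:R^-1.
  have mi i := mpmap_iter i pS mF1.
  have := @pr_bigcup_trivI _ _ _ nu (fun i => iter i S @^-1` F1) k (fun i => (mi i).1).
  rewrite (eq_bigr (fun _ => pr nu F1)) => [|i _]; last by have [] := mi i.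
  rewrite sumr_const card_ord -[_ *+ k]mulr_natl => le1.
  rewrite -[leRHS]mul1r ler_pdivlMr // mulrC; apply: le1.
  move=> i j ik jk [x [[t /= /andP[kt lt_kt] Lt] [s /= /andP[ks lt_ks] Ls]]].
  have := first_hit_shift (ltnW (ltn_trans ik lt_kt)) Lt.
  have := first_hit_shift (ltnW (ltn_trans jk lt_ks)) Ls.
  rewrite !(iter_cancel _ SK) => Ljs Lit.
  have := first_hit_inj Ljs Lit.
  move: kt ks lt_kt lt_ks ik jk => /dvdnP[a ->] /dvdnP[b ->].
  move=> lt_kt lt_ks ik jk eq_ij.
  have : (a * k + j = b * k + i)%N.
    by clear -eq_ij lt_kt lt_ks ik jk; lia.
  move=> /(congr1 (modn^~ k)).
  by rewrite !modnMDl !modn_small.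
have prF : pr nu F <= pr nu B + k%:R^-1.
  have : F `<=` B `|` F1.
    move=> x [t /= /andP[kt tk] Lt]; case: (posnP t) => [t0|t0].
      by left; move: Lt; rewrite t0 => -[].
    right; exists t => //=; rewrite kt ltn_neqAle eq_sym tk /=.
    exact: dvdn_leq.
  by move=> /(pr_subadd nu mF mB mF1) /le_trans; apply; rewrite lerD2l.
exists F, J; split => //.
- rewrite -subset0 => x [[t /= /andP[kt tk] Lt] [s /= /andP[s0 sk] Ls]].
  (* Level k is the only multiple of k strictly between 0 and 2 k. *)
  rewrite (first_hit_inj Ls Lt) {s Ls} in s0 sk.
  move: kt s0 sk tk => /dvdnP[a ->]; rewrite -muln2 mulnC.
  case: a => [|[|a]]; rewrite ?muln0 ?muln1 ?eqxx //.
  by rewrite ltn_pmul2l.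
- apply: (le_lt_trans (prU_le nu mF mJ)); move: prF k_e; set u := k%:R^-1; lra.
have V1 := hits_full mB B0; set V := \bigcup_t _ in V1.
have mV : measurable V.
  by apply: bigcupT_measurable => t; have [] := mpmap_iter t pQ mB.
have U0 : 0 < pr nu U.
  rewrite lt_neqAle pr_ge0 andbT eq_sym; apply/eqP => U0.
  (* If U is null, then so is level k, hence every later level, and the first
     k levels, none larger than B, cannot exhaust the space. *)
  have L0 t : (k <= t)%N -> pr nu (L t) = 0.
    move=> kt; apply/eqP; rewrite eq_le pr_ge0 andbT -U0.
    have [mU' <-] := mpmap_iter (t - k) pQ mU.
    apply: pr_le => // x Lt; exists k; first by clear -k_gt0; rewrite /= leqnn; lia.
    by rewrite -{1}(subKn kt); apply: first_hit_shift => //; exact: leq_subr.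
  pose W := \bigcup_(t in [set t | (k <= t)%N]) L t.
  have mW : measurable W by exact: bigcup_measurable.
  have prW : pr nu W <= 0.
    rewrite /W bigcup_mkcond; apply: pr_bigcup_le => [i|n].
      by case: ifP.
    rewrite big1 // => i _; case: ifPn => [|_]; last exact: pr0.
    by rewrite inE => /L0.
  have mI : measurable (\bigcup_(t in `I_k) L t) by exact: bigcup_measurable.
  have : V `<=` (\bigcup_(t in `I_k) L t) `|` W.
    move=> x [t _ /= /first_hit_ex [s Ls]].
    by case: (ltnP s k) => sk; [left|right]; exists s.
  move=> /(pr_subadd nu mV mI mW).
  have := pr_first_hits_le mB pQ k; rewrite -/L V1; lra.
have [|c c0 cU] := mildly_mixing_escape mpS SK QK pS pQ mm mU.
  by rewrite U0 /=; lra.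
exists (c / k%:R); first exact: divr_gt0.
apply: filterS cU => n cn; rewrite ler_pdivrMr //; apply: (le_trans cn).
have [mnU _] := mpmap_iter n pQ mU; have [mnF _] := mpmap_iter n pQ mF.
have mK : measurable ((iter n Q @^-1` F) `&` J) by exact: measurableI.
have mi i := mpmap_iter i pQ mK.
pose A i := iter i Q @^-1` ((iter n Q @^-1` F) `&` J).
have mA i : measurable (A i) := (mi i).1.
have [mnV] := mpmap_iter n pQ (measurableC mV).
rewrite [RHS]prC // V1 subrr => prnV.
have sub : U `\` (iter n Q @^-1` U) `<=`
    (\bigcup_(i in `I_k) A i) `|` (iter n Q @^-1` (~` V)).
  move=> x [[t /= /andP[kt tk] Lt] nU].
  case: (pselect (V (iter n Q x))) => [[s _ /= Bs]|]; last by right.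
  (* If tau = s at the point Q^n x, then after s mod k more steps tau is a
     multiple of k; it is not k itself because Q^n x is not in U. *)
  have [{Bs}s Ls] := first_hit_ex Bs; left; exists (s %% k)%N => /=.
    exact: ltn_pmod.
  have lek : (s %% k < k)%N by exact: ltn_pmod.
  split; last first.
    exists (t - s %% k)%N; last by apply: first_hit_shift => //; clear -kt lek; lia.
    by rewrite /=; clear -kt tk lek; lia.
  exists (s - s %% k)%N; last first.
    rewrite -iterD addnC iterD; apply: first_hit_shift => //.
    exact: leq_mod.
  rewrite /= {1}(divn_eq s k) addnK dvdn_mull //=; apply/eqP => sk.
  apply: nU; exists s => //=; clear -sk lek; lia.
have mD : measurable (U `\` (iter n Q @^-1` U)) by exact: measurableD.
have mUA : measurable (\bigcup_(i in `I_k) A i) by exact: bigcup_measurable.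
apply: (le_trans (pr_subadd nu mD mUA mnV sub)).
rewrite prnV addr0; apply: (le_trans (pr_bigcupn_le nu k mA)).
rewrite (eq_bigr (fun _ => pr nu ((iter n Q @^-1` F) `&` J))).
  by rewrite sumr_const card_ord mulr_natr.
by move=> i _; have [] := mi i.
Qed.

End lightly_meeting_pairs.

(** * Disjoint pairs of sets that keep meeting each other *)

Section lightly_meeting_family.
Context {R : realType} {d : measure_display} {Y : measurableType d}.
Variable nu : probability Y R.
Variables (S Q : Y -> Y).
Hypotheses (na : nonatomic nu) (mpS : mp_transformation nu S).
Hypotheses (SK : cancel S Q) (QK : cancel Q S).
Hypotheses (pS : mpmap nu S) (pQ : mpmap nu Q) (mm : mildly_mixing nu S).

(** The measure e_(t+1) allowed to the next pair depends on the lower bound c_t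
    of the current one, so that the later pairs cannot destroy it. *)
Lemma lightly_meeting_sequence : exists (F J : nat -> set Y) (e c : nat -> R),
  [/\ forall t, [/\ measurable (F t), measurable (J t) & F t `&` J t = set0],
      forall t, pr nu (F t `|` J t) < e t,
      forall t, 0 < c t /\ \forall n \near \oo,
        c t <= pr nu ((iter n Q @^-1` F t) `&` J t),
      e 0%N = 1 &
      forall t, [/\ 0 < e t, e t.+1 <= e t / 2 & e t.+1 <= c t / 8]].
Proof.
pose good (e : R) (w : set Y * set Y * R) := 0 < e ->
  [/\ measurable w.1.1, measurable w.1.2, w.1.1 `&` w.1.2 = set0,
      pr nu (w.1.1 `|` w.1.2) < e &
      0 < w.2 /\ \forall n \near \oo,
        w.2 <= pr nu ((iter n Q @^-1` w.1.1) `&` w.1.2)].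
have /choice[w wP] : forall e, exists w, good e w.
  move=> e; case: (ltP 0 e) => [e0|e0].
    have [F [J [mF mJ FJ0 FJe [c c0 cFJ]]]] :=
      lightly_meeting_pair na mpS SK QK pS pQ mm e0.
    by exists (F, J, c) => _; split.
  by exists (set0, set0, 0); rewrite /good ltNge e0.
pose e := fix e n := if n is n'.+1 then Num.min (e n' / 2) ((w (e n')).2 / 8)
  else 1 : R.
have e0 n : 0 < e n.
  elim: n => //= n en; have [_ _ _ _ [c0 _]] := wP _ en.
  by rewrite lt_min !divr_gt0.
exists (fun t => (w (e t)).1.1), (fun t => (w (e t)).1.2), e, (fun t => (w (e t)).2).
split => // t; have [? ? ? ? ?] := wP _ (e0 t) => //.
by split => //=; rewrite ge_min lexx ?orbT.
Qed.

(** The sets indexed by [true] play the role of F, those indexed by [false] the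
    role of J.  The set T m contains all pairs from the m-th on. *)
Lemma lightly_meeting_family :
  exists (D : nat -> bool -> set Y) (T : nat -> set Y),
  [/\ forall t b, measurable (D t b) /\ measurable (T t),
      forall m t b, (m <= t)%N -> D t b `<=` T m,
      forall t b s b' x, D t b x -> D s b' x -> t = s /\ b = b',
      forall e : R, 0 < e -> exists N, forall m, (N <= m)%N -> pr nu (T m) < e &
      forall t, exists2 c : R, 0 < c & \forall n \near \oo,
        c <= pr nu ((iter n Q @^-1` D t true) `&` D t false)].
Proof.
have [F [J [e [c [mFJ FJe cFJ e_0 eP]]]]] := lightly_meeting_sequence.
pose E t := F t `|` J t; pose T m := \bigcup_i E (m + i)%N.
have mF t : measurable (F t) by have [] := mFJ t.
have mJ t : measurable (J t) by have [] := mFJ t.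
have mE t : measurable (E t) by exact: measurableU.
have mT m : measurable (T m) by exact: bigcupT_measurable.
have ET m t : (m <= t)%N -> E t `<=` T m.
  by move=> mt x Ex; exists (t - m)%N => //; rewrite subnKC.
have prT m : pr nu (T m) <= 2 * e m.
  apply: pr_bigcup_le => // n.
  (* The e_t decrease at least geometrically; this bound is kept by induction. *)
  suff : \sum_(i < n) pr nu (E (m + i)%N) <= 2 * e m - 2 * e (m + n)%N.
    by have [] := eP (m + n)%N; lra.
  elim: n => [|n IH]; first by rewrite big_ord0 addn0 subrr.
  rewrite big_ord_recr /= addnS; have [_ h _] := eP (m + n)%N.
  have := FJe (m + n)%N; rewrite -/(E _); lra.
have e_le m : e m <= m.+1%:R^-1.
  elim: m => [|m IH]; first by rewrite e_0 invr1.
  have [_ h _] := eP m; apply: (le_trans h).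
  apply: (@le_trans _ _ (m.+1%:R^-1 / 2)); first by rewrite ler_pM2r.
  by rewrite -invfM lef_pV2 ?posrE ?mulr_gt0 ?ltr0n // -natrM ler_nat; lia.
pose D t b := (if b then F t else J t) `\` T t.+1.
have DE t b : D t b `<=` E t by case: b => x [? _]; [left|right].
have mD t b : measurable (D t b) by apply: measurableD => //; case: b.
exists D, T; split => //.
- by move=> m t b mt; apply: subset_trans (ET _ _ mt).
- have le t b s b' x : D t b x -> D s b' x -> (s <= t)%N.
    move=> [_ nT] /DE Es; rewrite leqNgt; apply/negP => ts.
    by apply: nT; exact: ET Es.
  move=> t b s b' x Dt Ds; have ts : t = s.
    by apply/eqP; rewrite eqn_leq (le _ _ _ _ _ Dt Ds) (le _ _ _ _ _ Ds Dt).
  subst s; split => //; have [_ _ FJ0] := mFJ t.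
  have nFJ : ~ (F t `&` J t) x by rewrite FJ0.
  by case: b Dt => -[? _]; case: b' Ds => -[? _] //; case: nFJ.
- move=> r r0; have r2 : 0 < r / 2 by lra.
  have [N _ NP] := near_infty_natSinv_lt (PosNum r2).
  exists N => m Nm; have := NP _ Nm; have := prT m; have := e_le m.
  by rewrite /=; set u := m.+1%:R^-1; lra.
move=> t; have [c0 cn] := cFJ t; exists (c t / 2); first lra.
apply: filterS cn => n cn.
have [mQT pQT] := mpmap_iter n pQ (mT t.+1).
have [mQF _] := mpmap_iter n pQ (mF t).
have [mQD _] := mpmap_iter n pQ (mD t true).
have mG : measurable ((iter n Q @^-1` D t true) `&` D t false).
  exact: measurableI.
(* What is lost by removing the later pairs is at most twice their measure,
   while this measure is at most c_t / 4. *)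
have sub : (iter n Q @^-1` F t) `&` J t `<=`
    ((iter n Q @^-1` D t true) `&` D t false) `|`
      ((iter n Q @^-1` T t.+1) `|` T t.+1).
  move=> x [Fx Jx].
  case: (pselect (T t.+1 x)) => [|nx]; first by right; right.
  case: (pselect (T t.+1 (iter n Q x))) => [|nQx]; first by right; left.
  by left.
have := pr_subadd nu (measurableI _ _ mQF (mJ t)) mG (measurableU _ _ mQT (mT t.+1)) sub.
have := prU_le nu mQT (mT t.+1); rewrite pQT.
have := prT t.+1; have [_ _] := eP t; lra.
Qed.

End lightly_meeting_family.

(** * The dense algebra *)

(** Numbering the pairs (r, x) makes each x occur infinitely often. *)
Lemma pickle_unbounded (T : countType) (x : T) m : exists t r,
  (m <= t)%N /\ unpickle t = Some (r, x) :> option (nat * T).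
Proof.
pose f r := pickle ((r, x) : nat * T).
have [r mr] : exists r, (m <= f r)%N.
  apply: contrapT => nr.
  have fm r : (f r < m)%N by rewrite ltnNge; apply/negP => mr; apply: nr; exists r.
  have inj : injective (fun i : 'I_m.+1 => Ordinal (fm i)).
    move=> i j /(congr1 val) /= /(pcan_inj pickleK) [].
    exact: val_inj.
  by have := leq_card _ inj; rewrite !card_ord ltnn.
by exists (f r), r; split => //; exact: pickleK.
Qed.

Section determined_sets.
Context {X : Type} (At : nat -> set X).

(** The sets that depend on the first m members of At only are the members of
    the finite algebra generated by them. *)
Definition determined (m : nat) (C : set X) : Prop := forall x y,
  (forall l, (l < m)%N -> At l x <-> At l y) -> C x -> C y.

Lemma determined_leq m n C : (m <= n)%N -> determined m C -> determined n C.
Proof.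
by move=> mn mC x y xy; apply: mC => l lm; apply: xy; exact: leq_trans mn.
Qed.

Lemma determinedC m C : determined m C -> determined m (~` C).
Proof.
move=> mC x y xy nCx Cy; apply: nCx; apply: mC Cy => l lm.
by split => /xy; apply.
Qed.

Lemma determinedU m C C' : determined m C -> determined m C' ->
  determined m (C `|` C').
Proof. by move=> mC mC' x y xy [/mC|/mC'] h; [left|right]; exact: h. Qed.

End determined_sets.

Lemma algebra_determined {d} {X : measurableType d} (At : nat -> set X) :
  algebra_of_sets [set C | measurable C /\ exists m, determined At m C].
Proof.
split.
- by split; [exact: measurableT|exists 0%N].
- move=> C [mC [m dC]]; split; first exact: measurableC.
  by exists m; exact: determinedC.
- move=> C C' [mC [m dC]] [mC' [m' dC']]; split; first exact: measurableU.
  exists (maxn m m'); apply: determinedU.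
    by apply: determined_leq dC; exact: leq_maxl.
  by apply: determined_leq dC'; exact: leq_maxr.
Qed.

Lemma separable_sequence {R : realType} {d} {X : measurableType d}
  (mu : probability X R) : separable_space mu ->
  exists a : nat -> set X, (forall i, measurable (a i)) /\
    forall A e, measurable A -> 0 < e -> exists i, pr mu (A `+` a i) < e.
Proof.
move=> [D /countable_injP[f finj] [mD dD]].
have /choice[a aP] : forall i, exists A, measurable A /\
    forall B, D B -> f B = i -> B = A.
  move=> i; case: (pselect (exists2 B, D B & f B = i)) => [[B DB fB]|nB].
    exists B; split => [|C DC fC]; first exact: mD.
    by apply: finj; rewrite ?inE // fC fB.
  by exists set0; split => // B DB fB; case: nB; exists B.
exists a; split => [i|A e mA e0]; first by have [] := aP i.
have [B DB AB] := dD A e mA e0; exists (f B).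
have [_ /(_ B DB erefl) <-] := aP (f B).
rewrite -lte_fin EFin_pr //; have mB := mD _ DB.
by apply: measurableU; apply: measurableD.
Qed.

Lemma limn_einf_gt0 {R : realType} (u : nat -> \bar R) (c : R) : 0 < c ->
  (\forall n \near \oo, (c%:E <= u n)%E) -> (0 < limn_einf u)%E.
Proof.
move=> c0 [N _ Nu]; apply: (@lt_le_trans _ _ c%:E); first by rewrite lte_fin.
rewrite limn_einf_lim; apply: lime_ge; first exact: is_cvg_einfs.
exists N => // n /= Nn; apply: le_ereal_inf_tmp => _ /= [k /= nk <-].
by apply: Nu => /=; exact: leq_trans nk.
Qed.

Section transfer.
Context {R : realType} {d d' : measure_display}.
Context {X : measurableType d} {Y : measurableType d'}.
Variables (mu : probability X R) (nu : probability Y R).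
Variables (T T' : X -> X) (S Q : Y -> Y) (p : X -> Y).
Hypotheses (TK : cancel T T') (TK' : cancel T' T) (pT' : mpmap mu T').
Hypotheses (SK : cancel S Q) (pQ : mpmap nu Q).
Hypotheses (mp : measurable_fun setT p).
Hypotheses (pp : forall C, measurable C -> mu (p @^-1` C) = nu C).
Hypotheses (pTS : {ae mu, forall x, p (T x) = S (p x)}).

(** The conjugacy p T = S p holds off a null set N; off the union K of the images
    of N under the powers of T, it can be iterated along backward orbits. *)
Lemma factor_meet_le (A B : set X) (F J : set Y) n :
  measurable A -> measurable B -> measurable F -> measurable J ->
  p @^-1` F `<=` A -> p @^-1` J `<=` B ->
  pr nu ((iter n Q @^-1` F) `&` J) <= pr mu ((iter n T @` A) `&` B).
Proof.
move=> mA mB mF mJ FA JB; rewrite (image_iter _ _ TK TK').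
have [N [mN N0 subN]] := pTS.
have mi j := mpmap_iter j pT' mN.
pose K := \bigcup_j (iter j T' @^-1` N).
have mK : measurable K by apply: bigcupT_measurable => j; have [] := mi j.
have K0 : pr mu K <= 0.
  apply: pr_bigcup_le => [j|m]; first by have [] := mi j.
  by rewrite big1 // => j _; have [_ ->] := mi j; rewrite /pr N0.
have conj x m : ~ K x -> p x = iter m S (p (iter m T' x)).
  move=> nK; elim: m => // m IH; rewrite {1}IH iterSr; congr (iter m S _).
  have : ~ N (iter m.+1 T' x) by move=> h; apply: nK; exists m.+1.
  move=> /(contra_notP (@subN _)) /=; rewrite TK'.
  by move=> <-.
have [mQF _] := mpmap_iter n pQ mF; have [mTA _] := mpmap_iter n pT' mA.
have mM : measurable ((iter n Q @^-1` F) `&` J) by exact: measurableI.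
have mpM : measurable (p @^-1` ((iter n Q @^-1` F) `&` J)).
  by rewrite -[_ @^-1` _]setTI; exact: mp.
have mI : measurable ((iter n T' @^-1` A) `&` B) by exact: measurableI.
have -> : pr nu ((iter n Q @^-1` F) `&` J) =
    pr mu (p @^-1` ((iter n Q @^-1` F) `&` J)) by rewrite /pr pp.
apply: le_trans (_ : _ <= pr mu ((iter n T' @^-1` A) `&` B) + pr mu K) _; last lra.
apply: pr_subadd => // x [/= Fx Jx].
case: (pselect (K x)) => [|nK]; first by right.
left; split; last exact: JB.
by apply: FA => /=; move: Fx; rewrite (conj x n nK) (iter_cancel n SK).
Qed.

End transfer.

Section dense_algebra.
Context {R : realType} {d d' : measure_display}.
Context {X : measurableType d} {Y : measurableType d'}.
Variables (mu : probability X R) (nu : probability Y R) (p : X -> Y).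
Hypotheses (mp : measurable_fun setT p).
Hypotheses (pp : forall C, measurable C -> mu (p @^-1` C) = nu C).
Variables (D : nat -> bool -> set Y) (T : nat -> set Y).
Hypotheses (mD : forall t b, measurable (D t b)) (mT : forall m, measurable (T m)).
Hypotheses (DT : forall m t b, (m <= t)%N -> D t b `<=` T m).
Hypotheses (Ddisj : forall t b s b' x, D t b x -> D s b' x -> t = s /\ b = b').

(** In the code of t, the unnamed first component only serves to repeat each pair
    of words infinitely often. *)
Definition word (t : nat) (b : bool) : seq bool :=
  if (unpickle t : option (nat * (seq bool * seq bool))) is Some (_, w)
  then (if b then w.1 else w.2) else [::].

Lemma word_onto (w w' : seq bool) m :
  exists2 t, (m <= t)%N & word t true = w /\ word t false = w'.
Proof.
have [t [r [mt tE]]] := pickle_unbounded (w, w') m.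
by exists t; rewrite // /word tE.
Qed.

(** Over the tail T m, the set a m is forgotten, and the fibres over the marker
    sets [D t b] are included or excluded as told by the m-th bit of the word;
    over the rest of the tail nothing is included. *)
Definition recoded (a : nat -> set X) (m : nat) : set X :=
  (a m `\` p @^-1` T m) `|` p @^-1` (\bigcup_(t in [set t | (m <= t)%N])
    \bigcup_(b in [set b | nth false (word t b) m]) D t b).

Lemma measurable_preimage C : measurable C -> measurable (p @^-1` C).
Proof. by move=> mC; rewrite -[_ @^-1` _]setTI; exact: mp. Qed.

Lemma measurable_recoded a m : measurable (a m) -> measurable (recoded a m).
Proof.
move=> ma; apply: measurableU.
  by apply: measurableD => //; exact: measurable_preimage.
apply: measurable_preimage; apply: bigcup_measurable => t _.
rewrite bigcup_mkcond; apply: countable_bigcupT_measurable => [|b].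
  exact: countableP.
by case: ifP.
Qed.

(** On the fibre over [D t b], the membership in the recoded sets of index at most
    t is constant and spelled by the word: this is what the markers are for. *)
Lemma recoded_on a m t b x : (m <= t)%N -> D t b (p x) ->
  recoded a m x <-> nth false (word t b) m.
Proof.
move=> mt Dx; split => [[[_]|[s /= ms [b' wb' Dx']]]|wb].
- by case; exact: DT Dx.
- by have [-> ->] := Ddisj Dx Dx'.
- by right; exists t => //=; exists b.
Qed.

Lemma recoded_close a m : (forall i, measurable (a i)) ->
  pr mu (a m `+` recoded a m) <= pr nu (T m).
Proof.
move=> ma; have -> : pr nu (T m) = pr mu (p @^-1` T m) by rewrite /pr pp.
have mr := measurable_recoded (ma m).
apply: pr_le; [|exact: measurable_preimage|].
  by apply: measurableU; apply: measurableD.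
move=> x [[ax nr]|[[[ax _]|[t /= mt [b _ Dx]]] nax]] //=.
  by apply: contrapT => nT; apply: nr; left.
exact: DT Dx.
Qed.

(** A fibre whose word records the position of x with respect to the first m
    recoded sets cannot be told from x by a set that depends on these only. *)
Lemma determined_contains a m C b x : determined (recoded a) m C -> C x ->
  forall t, (m <= t)%N ->
  word t b = [seq `[< recoded a l x >] | l <- iota 0 m] -> p @^-1` D t b `<=` C.
Proof.
move=> dC Cx t mt wt y Dy; apply: dC Cx => l lm.
have lt : (l <= t)%N by exact: leq_trans (ltnW lm) mt.
have := recoded_on a lt Dy.
rewrite wt (nth_map 0%N) ?size_iota // nth_iota // add0n => yE.
by split=> [h|/yE/asboolP //]; apply/yE/asboolP.
Qed.

End dense_algebra.

Theorem theorem4p4 (R : realType)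
  (d : measure_display) (X : measurableType d) (mu : probability X R)
  (T : X -> X)
  (separable_mu : separable_space mu) (nonatomic_mu : nonatomic mu)
  (mp_T : mp_transformation mu T)
  (mm_factor : exists (d' : measure_display) (Y : measurableType d')
    (nu : probability Y R) (S : Y -> Y),
    [/\ separable_space nu, nonatomic nu,
        is_factor mu T nu S & mildly_mixing nu S]) :
  lightly_mixing_on_dense_algebra mu T.
Proof.
have [d' [Y [nu [S [_ na [mpS [p [mp pp pTS]]] mm]]]]] := mm_factor.
have [T' [TK TK' _ pT']] := mp_inverse mp_T.
have [Q [SK QK pS pQ]] := mp_inverse mpS.
have [D [V [mDV DV Ddisj V0 Dmeet]]] := lightly_meeting_family na mpS SK QK pS pQ mm.
have mD t b : measurable (D t b) by have [] := mDV t b.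
have mV m : measurable (V m) by have [] := mDV m true.
have [a0 [ma0 a0P]] := separable_sequence separable_mu.
(* The dense sequence is repeated so that each set occurs at arbitrarily
   large indices m, where it is recoded on an arbitrarily small tail. *)
pose a m := if (unpickle m : option (nat * nat)) is Some (_, i) then a0 i else set0.
have ma m : measurable (a m) by rewrite /a; case: unpickle => // -[].
pose A := recoded p D V a.
have mA m : measurable (A m) by exact: measurable_recoded.
exists [set C | measurable C /\ exists m, determined A m C]; split.
- exact: algebra_determined.
- split=> [C []//|C e mC e0]; have e2 : 0 < e / 2 by lra.
  have [i Ci] := a0P _ _ mC e2.
  have [N NP] := V0 _ e2.
  have [m [r [Nm mE]]] := pickle_unbounded i N.
  have am : a m = a0 i by rewrite /a mE.
  exists (A m).
    by split => //; exists m.+1 => x y /(_ m (leqnn _)) [].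
  have mY (B1 B2 : set X) : measurable B1 -> measurable B2 -> measurable (B1 `+` B2).
    by move=> m1 m2; apply: measurableU; apply: measurableD.
  have m1 := mY _ _ mC (ma m); have m2 := mY _ _ (ma m) (mA m).
  have m3 := mY _ _ mC (mA m).
  have sub : C `+` A m `<=` (C `+` a m) `|` (a m `+` A m).
    move=> x; case: (pselect (a m x)) => ax [] [] h1 h2.
    + by right; left.
    + by left; right.
    + by left; left.
    + by right; right.
  rewrite -EFin_pr // lte_fin; apply: (le_lt_trans (pr_subadd mu m3 m1 m2 sub)).
  have := recoded_close mp pp mD mV DV m ma; rewrite -/A.
  have := NP m Nm; rewrite am; lra.
move=> B C [mB [m dB]] [mC [m' dC]] B0 C0.
have nonempty (E : set X) : (0 < mu E)%E -> exists x, E x.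
  by move=> E0; apply/set0P; apply: contraTneq E0 => ->; rewrite measure0 ltxx.
have [x Bx] := nonempty _ B0; have [y Cy] := nonempty _ C0.
pose M := maxn m m'.
have {}dB : determined A M B by apply: determined_leq dB; exact: leq_maxl.
have {}dC : determined A M C by apply: determined_leq dC; exact: leq_maxr.
have [t Mt [wB wC]] := word_onto
  [seq `[< A l x >] | l <- iota 0 M] [seq `[< A l y >] | l <- iota 0 M] M.
have DB := determined_contains DV Ddisj dB Bx Mt wB.
have DC := determined_contains DV Ddisj dC Cy Mt wC.
have [c c0 cD] := Dmeet t; apply: (limn_einf_gt0 c0); apply: filterS cD => n cn.
have [mTB _] := mpmap_iter n pT' mB.
rewrite (image_iter _ _ TK TK') -EFin_pr ?lee_fin; last exact: measurableI.
rewrite -(image_iter _ _ TK TK'); apply: (le_trans cn).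
exact: (factor_meet_le TK TK' pT' SK pQ mp pp pTS).
Qed.
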